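(* Suppose that the Kolakoski sequence $S$ has no $\infty$-regular subrow. Then, if $S$ is recurrent, $S$ is mirror invariant.
   Context: Words are over the alphabet $\{1,2\}$; $|v|$ is the length of $v$. For a finite or infinite word $v=a_1a_2\cdots$, its integral $v^{-1}$ is obtained by replacing each letter $a_i$ by $a_i$ copies of the letter $1$ if $i$ is odd and by $a_i$ copies of the letter $2$ if $i$ is even. Set $v^0=v$, $v^{-k}=(v^{-(k-1)})^{-1}$. The Kolakoski sequence $S=s_1s_2\cdots=1221121221\cdots$ is the unique infinite word over $\{1,2\}$ with $S^{-1}=S$. For $1\le a\le b$ write $S_{a,b}=s_a\cdots s_b$. A subrow of $S$ is a particular occurrence $S_{a,b}$ (a pair consisting of the word and its starting position $a$). The $S$-integral of the subrow $w=S_{a,b}$ is the subrow $w_S^{-1}:=S_{|u^{-1}|+1,\;|u^{-1}|+|w^{-1}|}$, where $u=s_1\cdots s_{a-1}$ (empty if $a=1$); iterate: $w_S^{-n}=(w_S^{-(n-1)})_S^{-1}$, $w_S^{0}=w$. A subrow $w$ is $\infty$-regular if $|w_S^{-h}|$ is even for every integer $h\ge 0$. $S$ is recurrent if every finite subword of $S$ occurs at least twice in $S$. The mirror $\widetilde{v}$ of a word $v$ is obtained by exchanging $1\leftrightarrow 2$; $S$ is mirror invariant if the set of its finite subwords is closed under $v\mapsto\widetilde v$. *)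

(* Defs.v *)
From mathcomp Require Import all_boot.

Set Implicit Arguments.
Unset Strict Implicit.
Unset Printing Implicit Defensive.

(* The alphabet {1, 2} is encoded by bool: the boolean a stands for the letter
   a.+1, so false is the letter 1 and true is the letter 2. *)
Definition letter := bool.
Definition one : letter := false.
Definition two : letter := true.
Definition lval (a : letter) : nat := a.+1.

Definition word := seq letter.

(* Infinite words are indexed from 0: for v = a_1 a_2 ..., the letter a_i is
   v i.-1.  Everywhere else positions start at 1. *)
Definition infword := nat -> letter.

(* [runs c v] replaces the letters of v by runs of the letters
   c, ~~ c, c, ...; the odd (1-based) positions receive the letter c. *)
Fixpoint runs (c : letter) (v : word) : word :=
  if v is a :: v' then nseq (lval a) c ++ runs (~~ c) v' else [::].

Definition integral (v : word) : word := runs one v.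

(* The integrals of the prefixes of v are prefixes of the integral of v, and
   the integral of the prefix of length n.+1 has at least n.+1 letters. *)
Definition inf_integral (v : infword) : infword :=
  fun n => nth one (integral (mkseq v n.+1)) n.

Definition kolakoski (S : infword) : Prop := inf_integral S =1 S.

(* The word s_a ... s_b (1-based, empty when b < a). *)
Definition factor (S : infword) (a b : nat) : word :=
  [seq S i.-1 | i <- iota a (b.+1 - a)].

(* A pair (a, b) with 1 <= a <= b encodes the subrow S_{a,b}, that is the word
   s_a ... s_b together with its starting position a. *)
Definition subrow := (nat * nat)%type.

Definition is_subrow (w : subrow) : bool := (0 < w.1) && (w.1 <= w.2).

Definition subrow_word (S : infword) (w : subrow) : word := factor S w.1 w.2.

Definition subrow_integral (S : infword) (w : subrow) : subrow :=
  let p := size (integral (factor S 1 w.1.-1)) in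
  (p.+1, p + size (integral (subrow_word S w))).

Definition infty_regular (S : infword) (w : subrow) : Prop :=
  forall h : nat, ~~ odd (size (subrow_word S (iter h (subrow_integral S) w))).

Definition occurs_at (S : infword) (v : word) (a : nat) : Prop :=
  0 < a /\ factor S a (a + size v).-1 = v.

Definition subword (S : infword) (v : word) : Prop :=
  exists a : nat, occurs_at S v a.

Definition recurrent (S : infword) : Prop :=
  forall v : word, subword S v ->
    exists a b : nat, [/\ a <> b, occurs_at S v a & occurs_at S v b].

Definition mirror (v : word) : word := map negb v.

Definition mirror_invariant (S : infword) : Prop :=
  forall v : word, subword S v -> subword S (mirror v).

Lemma size_runs_ge c v : size v <= size (runs c v).
Proof.
elim: v c => //= a v IHv c.
by rewrite size_cat ltnS (leq_trans (IHv (~~ c))) ?leq_addl.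
Qed.

Lemma size_runs_gt c v : two \in v -> size v < size (runs c v).
Proof.
elim: v c => //= a v IHv c; rewrite in_cons size_cat size_nseq.
case/orP=> [/eqP <- | /IHv lt_v].
  by rewrite !ltnS size_runs_ge.
by rewrite ltnS (leq_trans (lt_v (~~ c))) ?leq_addl.
Qed.

Lemma runs_cat c u v : prefix (runs c u) (runs c (u ++ v)).
Proof.
elim: u c => [|a u IHu] c /=; first by rewrite prefix0s.
have /prefixP[t ->] := IHu (~~ c).
by rewrite eqxx catA prefix_prefix.
Qed.

Lemma integral_prefix u v : prefix u v -> prefix (integral u) (integral v).
Proof. by case/prefixP=> t ->; apply: runs_cat. Qed.

Lemma prefix_nth (u v : word) i :
  prefix u v -> i < size u -> nth one v i = nth one u i.
Proof. by case/prefixP=> t -> lt_i; rewrite nth_cat lt_i. Qed.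

Lemma subrow_integral_valid S w :
  is_subrow w -> is_subrow (subrow_integral S w).
Proof.
case: w => a b /andP[/= a_gt0 le_ab]; rewrite /is_subrow /= -addn1 leq_add2l.
apply: leq_trans (size_runs_ge _ _).
by rewrite size_map size_iota subn_gt0 ltnS.
Qed.

Lemma kolakoski_start S : kolakoski S -> S 0 = one /\ S 1 = two.
Proof.
move=> kS; have S0 : S 0 = one by rewrite -kS /inf_integral /=; case: (S 0).
by split=> //; rewrite -kS /inf_integral /= S0; case: (S 1).
Qed.

Lemma kolakoski_step S n : kolakoski S -> 1 < n ->
  S n = nth one (integral (mkseq S n)) n.
Proof.
move=> kS n_gt1; have [_ S1] := kolakoski_start kS.
rewrite -{1}kS; apply: prefix_nth.
  by apply: integral_prefix; rewrite mkseqS -cats1 prefix_prefix.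
rewrite -{1}(size_mkseq S n) size_runs_gt //.
by rewrite -S1; apply: map_f; rewrite mem_iota.
Qed.

Lemma kolakoski_unique S T : kolakoski S -> kolakoski T -> S =1 T.
Proof.
move=> kS kT n; elim/ltn_ind: n => n IHn.
have [S0 S1] := kolakoski_start kS; have [T0 T1] := kolakoski_start kT.
case: n IHn => [|[|n]] IHn; rewrite ?S0 ?S1 //.
rewrite (kolakoski_step kS) // (kolakoski_step kT) //.
suff -> : mkseq S n.+2 = mkseq T n.+2 by [].
by apply/eq_in_map=> i; rewrite mem_iota => /IHn.
Qed.

Definition kolakoski_prefix (n : nat) : word := iter n integral [:: one; two].

Lemma kolakoski_prefix_le m n :
  m <= n -> prefix (kolakoski_prefix m) (kolakoski_prefix n).
Proof.
move/subnKC <-; elim: (n - m) => [|k IHk]; first by rewrite addn0 prefix_refl.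
rewrite addnS; apply: prefix_trans IHk _.
by elim: (m + k) => //= i; apply: integral_prefix.
Qed.

Lemma kolakoski_prefix_size n : n.+1 < size (kolakoski_prefix n).
Proof.
elim: n => //= n IHn; apply: leq_ltn_trans IHn _; apply: size_runs_gt.
have /prefixP[t ->] : prefix [:: one; two] (kolakoski_prefix n).
  exact: (@kolakoski_prefix_le 0).
by rewrite mem_cat.
Qed.

Lemma kolakoski_exists : exists S, kolakoski S.
Proof.
pose S n := nth one (kolakoski_prefix n) n; exists S => n.
have pS : prefix (mkseq S n.+1) (kolakoski_prefix n).
  have le_n : n.+1 <= size (kolakoski_prefix n).
    exact: ltnW (kolakoski_prefix_size n).
  suff -> : mkseq S n.+1 = take n.+1 (kolakoski_prefix n) by exact: prefix_take.
  apply: (@eq_from_nth _ one) => [|i]; rewrite size_mkseq.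
    by rewrite size_takel.
  move=> lt_i; rewrite nth_mkseq // nth_take //; apply/esym/prefix_nth.
    exact: kolakoski_prefix_le.
  exact: ltnW (kolakoski_prefix_size i).
have pI : prefix (integral (mkseq S n.+1)) (kolakoski_prefix n.+1).
  exact: integral_prefix pS.
rewrite /inf_integral -(prefix_nth pI); last first.
  by apply: leq_trans (size_runs_ge _ _); rewrite size_mkseq.
apply: prefix_nth; first exact: kolakoski_prefix_le.
exact: ltnW (kolakoski_prefix_size n).
Qed.

(* Main.v *)
Require Import Defs.
From mathcomp Require Import all_boot.
From Stdlib Require Import Classical.

(** Since S is recurrent, a prefix P of S occurs again, right after some
    nonempty prefix w. The integrals of P and w are again prefixes of S, and as
    long as w has even length the integral of P again follows that of w. As w is
    not infinitely regular, some iterated integral of w has odd length; at the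
    next integration the runs start with the letter 2 instead of 1, so a mirrored
    prefix of S at least as long as P appears. *)

Set Implicit Arguments.
Unset Strict Implicit.
Unset Printing Implicit Defensive.

(** Each letter of [u] gives one run and flips the run letter, so the parity of [size u] decides how
    the runs of [v] start. *)
Lemma runs_catE c u v :
  runs c (u ++ v) = runs c u ++ runs (odd (size u) (+) c) v.
Proof.
elim: u c => //= a u IHu c.
by rewrite IHu catA addNb addbN.
Qed.

Lemma mirror_runs c v : mirror (runs c v) = runs (~~ c) v.
Proof. by rewrite /mirror; elim: v c => //= a v IHv c; rewrite map_cat map_nseq IHv. Qed.

Lemma prefix_mkseq (S : infword) m n : m <= n -> prefix (mkseq S m) (mkseq S n).
Proof. by move/subnKC<-; rewrite /mkseq iotaD map_cat prefix_prefix. Qed.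

Lemma factor_mkseq (S : infword) a n :
  factor S a.+1 (a + n) = [seq S i | i <- iota a n].
Proof.
by rewrite /factor subSS addKn (iotaDl 1 a) -map_comp; apply: eq_map.
Qed.

Lemma mkseqD_factor (S : infword) a n :
  mkseq S (a + n) = mkseq S a ++ factor S a.+1 (a + n).
Proof. by rewrite factor_mkseq /mkseq iotaD map_cat. Qed.

Lemma occurs_atP (S : infword) v a :
  occurs_at S v a.+1 <-> mkseq S (a + size v) = mkseq S a ++ v.
Proof.
rewrite mkseqD_factor; split=> [[_ /= -> //]|/eqP].
by rewrite eqseq_cat // => /andP[_ /eqP eq_v]; split.
Qed.

Lemma subword_cat S u v w : subword S (u ++ v ++ w) -> subword S v.
Proof.
case=> -[[]//|a /occurs_atP eq_a]; exists (a + size u).+1; apply/occurs_atP.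
have: prefix (mkseq S (a + size u + size v)) (mkseq S (a + size (u ++ v ++ w))).
  by apply: prefix_mkseq; rewrite !size_cat -addnA leq_add2l addnA leq_addr.
have: prefix (mkseq S (a + size u)) (mkseq S (a + size (u ++ v ++ w))).
  by apply: prefix_mkseq; rewrite !size_cat leq_add2l leq_addr.
have sz_au : size (mkseq S a ++ u) = a + size u by rewrite size_cat size_mkseq.
rewrite !prefixE !size_mkseq eq_a catA => /eqP <- /eqP <-.
by rewrite -sz_au -size_cat [in RHS]take_size_cat // catA take_size_cat.
Qed.

Section Kolakoski.
Variables (S : infword) (kS : kolakoski S).

Let isize a := size (integral (mkseq S a)).

(** Letter [i] is read off the integral of the prefix of length [i.+1]. That prefix and [mkseq S a]
    are comparable, hence so are their integrals. *)
Lemma integral_mkseq a : integral (mkseq S a) = mkseq S (isize a).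
Proof.
apply: (@eq_from_nth _ Defs.one) => [|i lt_i]; rewrite ?size_mkseq //.
rewrite nth_mkseq // -kS /inf_integral.
have [le_ia|lt_ai] := leqP i.+1 a.
  apply: prefix_nth; first exact/integral_prefix/prefix_mkseq.
  by apply: leq_trans (size_runs_ge _ _); rewrite size_mkseq.
by apply/esym/prefix_nth => //; exact/integral_prefix/prefix_mkseq/ltnW.
Qed.

Lemma isize_ge a : a <= isize a.
Proof. by rewrite -{1}(size_mkseq S a) size_runs_ge. Qed.

(** Nothing precedes a subrow at position 1, so its integrals start there too and only the length
    evolves. *)
Lemma iter_subrow_integral h a :
  iter h (subrow_integral S) (1, a) = (1, iter h isize a).
Proof.
elim: h => //= h ->; rewrite /subrow_integral /=.
by rewrite /subrow_word -[iter h isize a]add0n factor_mkseq.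
Qed.

Lemma occurs_integral v a : occurs_at S v a.+1 ->
  occurs_at S (runs (odd a) v) (isize a).+1.
Proof.
move=> /occurs_atP eq_a; apply/occurs_atP.
have := integral_mkseq (a + size v).
rewrite /isize eq_a /integral runs_catE size_mkseq addbF -/(integral _) size_cat.
by rewrite integral_mkseq size_mkseq => ->.
Qed.

Lemma mirror_prefix_subword h a k : occurs_at S (mkseq S k) a.+1 ->
  odd (iter h isize a) -> subword S (mirror (mkseq S k)).
Proof.
(* Integration may lengthen the prefix, so the induction gives some [k'] at least [k]; the excess is
   cut off here. *)
move=> occ_k odd_h; suff [k' le_k sub_k'] :
    exists2 k', k <= k' & subword S (mirror (mkseq S k')).
  have /prefixP[t eq_t] := prefix_mkseq S le_k.
  by apply: (@subword_cat _ [::] _ (mirror t)); rewrite /= /mirror -map_cat -eq_t.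
elim: h a k occ_k odd_h => [|h IHh] a k occ_k; rewrite ?iterSr => odd_h.
  exists (isize k); first exact: isize_ge.
  exists (isize a).+1; rewrite -integral_mkseq mirror_runs.
  by move: (occurs_integral occ_k); rewrite odd_h.
(* For odd [a] the runs start with [two], which ends the search early; for even [a] they form a
   prefix of [S] again, now after [isize a] letters. *)
have := occurs_integral occ_k; case odd_a: (odd a) => occ_k'.
  exists (isize k); first exact: isize_ge.
  by exists (isize a).+1; rewrite -integral_mkseq mirror_runs.
rewrite -/(integral _) integral_mkseq in occ_k'.
have [k' le_k' sub_k'] := IHh _ _ occ_k' odd_h.
by exists k' => //; apply: leq_trans (isize_ge k) le_k'.
Qed.

End Kolakoski.

Theorem theorem2 (S : infword) (hS : kolakoski S)
    (hreg : ~ exists w : subrow, is_subrow w /\ infty_regular S w) :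
  recurrent S -> mirror_invariant S.
Proof.
move=> recS v [[[]//|b /occurs_atP eq_v]].
(* The prefix of length [n] ends with [v], so its mirror ends with that of [v]. *)
set n := b + size v in eq_v.
suff sub_n : subword S (mirror (mkseq S n)).
  apply: (@subword_cat _ (mirror (mkseq S b)) _ [::]).
  by rewrite cats0 /mirror -map_cat -eq_v.
have [a a_gt0 occ_a] : exists2 a, 0 < a & occurs_at S (mkseq S n) a.+1.
  have [|a [a' [neq_a occ_a occ_a']]] := recS (mkseq S n).
    by exists 1; apply/occurs_atP; rewrite size_mkseq.
  (* Of two distinct positions, at least one is not 1. *)
  case: a occ_a neq_a => [[]//|[|a]] occ_a neq_a; last by exists a.+1.
  by case: a' occ_a' neq_a => [[]//|[|a']] // occ_a' _; exists a'.+1.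
have [h odd_h] : exists h, odd (iter h (fun a => size (integral (mkseq S a))) a).
  apply: NNPP => all_even; apply: hreg; exists (1, a); split=> // h.
  rewrite iter_subrow_integral /subrow_word -[X in factor _ _ X]add0n.
  rewrite factor_mkseq size_map size_iota; apply/negP => odd_h.
  by apply: all_even; exists h.
exact: mirror_prefix_subword occ_a odd_h.
Qed.
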